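(* Let $\alpha\in\{U,\ UU,\ UD,\ UF,\ DU,\ FU\}$ and $n\geq 0$. The number of $\alpha$-equivalence classes of the set $\mathcal{L}_n$ of Łukasiewicz paths of length $n$ equals the number of $\alpha$-equivalence classes of the set $\mathcal{M}_n$ of Motzkin paths of length $n$.
   Context: A lattice path of length $n$ is a sequence of $n$ steps from $\{(1,i): i\in\mathbb{Z}\}$ starting at $(0,0)$, ending at $(n,0)$ and never going below the $x$-axis. Write $D=(1,-1)$, $F=(1,0)$, $U=U_1=(1,1)$ and $U_i=(1,i)$ for $i\geq 2$. A Łukasiewicz path is a lattice path with steps in $\{(1,i): i\geq -1\}$; a Motzkin path is a lattice path with steps in $\{U,F,D\}$. $\mathcal{L}_n$ and $\mathcal{M}_n$ denote the sets of Łukasiewicz, resp. Motzkin, paths of length $n$. Steps are numbered $1,\dots,n$; an occurrence of a pattern (one step, or two consecutive steps) is at position $i$ if its first step is the $i$-th step. Two paths of the same length are $\alpha$-equivalent if the sets of occurrence positions of $\alpha$ in them are identical; on $\mathcal{M}_n$ the same relation is used (restricted to $\mathcal{M}_n$). *)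

(* Defs.v *)
From mathcomp Require Import all_boot all_order all_algebra.
From mathcomp Require Import boolp classical_sets functions cardinality.

Set Implicit Arguments.
Unset Strict Implicit.
Unset Printing Implicit Defensive.

Import Order.TTheory GRing.Theory Num.Theory.
Local Open Scope ring_scope.
Local Open Scope classical_set_scope.

(* The step (1, i) is encoded by the integer i; the path starts at (0, 0), so it
   is determined by its sequence of steps. *)
Definition D : int := -1.
Definition F : int := 0.
Definition U : int := 1.

(* Ordinate of the point reached after the first k steps. *)
Definition height (p : seq int) (k : nat) : int := \sum_(s <- take k p) s.

Definition lattice_path (n : nat) (p : n.-tuple int) : Prop :=
  (forall k, (k <= n)%N -> 0 <= height p k) /\ height p n = 0.

Definition Lukasiewicz (n : nat) : set (n.-tuple int) :=
  [set p | lattice_path p /\ forall s, s \in p -> -1 <= s].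

Definition Motzkin (n : nat) : set (n.-tuple int) :=
  [set p | lattice_path p /\ forall s, s \in p -> s \in [:: U; F; D]].

(* Positions are numbered from 1. *)
Definition occurs_at (alpha p : seq int) (i : nat) : Prop :=
  (1 <= i)%N /\ prefix alpha (drop i.-1 p).

Definition positions (alpha p : seq int) : set nat :=
  [set i | occurs_at alpha p i].

Definition alpha_equiv (alpha : seq int) (n : nat) (p q : n.-tuple int) : Prop :=
  positions alpha p = positions alpha q.

Definition equiv_classes (alpha : seq int) (n : nat) (A : set (n.-tuple int)) :
    set (set (n.-tuple int)) :=
  [set C | exists2 p, A p & C = [set q | A q /\ alpha_equiv alpha p q]].

(* Main.v *)
(* Any Lukasiewicz path p is alpha-equivalent to a Motzkin path q, so that both
   families realize the same sets of occurrence positions, and classes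
   correspond to these sets.  For alpha other than DU, q keeps the steps U and F
   of p lying in an occurrence of alpha and otherwise descends as soon as it can
   (D above the axis, F on it); then q stays weakly below p, hence ends on the
   axis.  For alpha = DU, q is flat at ordinate 1 between a first step U and a
   last step D, except for the valleys at the occurrences of DU (q = F^n when
   there is none). *)
Require Import Defs.
From mathcomp Require Import all_boot all_order all_algebra.
From mathcomp Require Import boolp classical_sets functions cardinality.
From mathcomp Require Import zify.

Set Implicit Arguments.
Unset Strict Implicit.
Unset Printing Implicit Defensive.

Import Order.TTheory GRing.Theory Num.Theory.
Local Open Scope classical_set_scope.
Local Open Scope card_scope.

(** * Heights and pattern occurrences, read step by step *)

Lemma height0 (p : seq int) : height p 0 = 0%R.
Proof. by rewrite /height take0 big_nil. Qed.

Lemma heightS (p : seq int) (k : nat) :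
  height p k.+1 = (height p k + nth 0%R p k)%R.
Proof.
rewrite /height; case: (ltnP k (size p)) => hk.
  by rewrite (take_nth 0%R hk) -cats1 big_cat big_seq1.
by rewrite nth_default // addr0 !take_oversize // ltnW.
Qed.

Lemma prefix_nthP (T : eqType) (x : T) (s t : seq T) :
  reflect (size s <= size t /\ forall j, j < size s -> nth x t j = nth x s j)
          (prefix s t).
Proof.
rewrite prefixE; apply: (iffP eqP) => [<-|[hs hst]].
  rewrite size_take_min; split=> [|j]; first exact: geq_minr.
  by rewrite leq_min => /andP[hj _]; rewrite nth_take.
apply: (@eq_from_nth _ x) => [|j]; first by rewrite size_takel.
by rewrite size_takel // => hj; rewrite nth_take // hst.
Qed.

(* Occurrences are indexed from 0 here, as in [nth]. *)
Definition occ (alpha p : seq int) (i : nat) : bool := prefix alpha (drop i p).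

Lemma occP (alpha p : seq int) (i : nat) : 0 < size alpha ->
  reflect (i + size alpha <= size p /\
           forall j, j < size alpha -> nth 0%R p (i + j) = nth 0%R alpha j)
          (occ alpha p i).
Proof.
move=> ha; apply: (iffP (prefix_nthP 0%R _ _)); rewrite size_drop => -[hs h].
  by split=> [|j hj]; [rewrite -leq_psubRL|rewrite -nth_drop h].
by split=> [|j hj]; [rewrite leq_psubRL|rewrite nth_drop h].
Qed.

Lemma eq_positions (alpha p q : seq int) :
  occ alpha p =1 occ alpha q -> positions alpha p = positions alpha q.
Proof.
move=> h; apply/seteqP; split=> i [i0 hi]; split=> //.
  by have := h i.-1; rewrite /occ hi => <-.
by have := h i.-1; rewrite /occ hi => ->.
Qed.

Lemma occ1P (x : int) (p : seq int) (i : nat) :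
  reflect (i < size p /\ nth 0%R p i = x) (occ [:: x] p i).
Proof.
apply: (iffP (@occP [:: x] _ _ isT)) => /= -[hs h].
  by split; [lia|have := h 0 isT; rewrite addn0].
by split=> [|[|//] _]; [lia|rewrite addn0].
Qed.

Lemma occ2P (x y : int) (p : seq int) (i : nat) :
  reflect [/\ i.+1 < size p, nth 0%R p i = x & nth 0%R p i.+1 = y]
          (occ [:: x; y] p i).
Proof.
apply: (iffP (@occP [:: x; y] _ _ isT)) => /= [[hs h]|[hs h0 h1]].
  by split; [lia|have := h 0 isT; rewrite addn0|have := h 1 isT; rewrite addn1].
by split=> [|[|[|//]] _]; [lia|rewrite addn0|rewrite addn1].
Qed.

Definition steps (n : nat) (a : nat -> int) : n.-tuple int :=
  mktuple (fun i : 'I_n => a i).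

Lemma nth_steps (n : nat) (a : nat -> int) (k : nat) :
  k < n -> nth 0%R (steps n a) k = a k.
Proof. by move=> hk; rewrite -[k]/(val (Ordinal hk)) -tnth_nth tnth_mktuple. Qed.

(** Allows a height profile [h] to be proposed beforehand: once it obeys the recursion of the steps
    it agrees with [height], and the path conditions are checked on [h]. *)
Lemma Motzkin_steps (n : nat) (a h : nat -> int) :
  h 0 = 0%R -> (forall k, k < n -> h k.+1 = (h k + a k)%R) ->
  (forall k, k <= n -> (0 <= h k)%R) -> h n = 0%R ->
  (forall k, k < n -> a k \in [:: U; F; D]) -> Motzkin (steps n a).
Proof.
move=> h0 hS hge hn ha.
have hE k : k <= n -> height (steps n a) k = h k.
  elim: k => [|k IH] hk; first by rewrite height0.
  by rewrite heightS nth_steps // hS // IH // ltnW.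
split; first by split=> [k hk|]; rewrite hE ?hge.
by move=> s /mapP[i _ ->]; exact: ha.
Qed.

(** * Lowering a path, for the patterns other than DU *)

Section Lowering.

Variables (alpha p : seq int).

(** The test [j <= k] guards against truncated subtraction. Steps D are left out: the descent rule
    recreates the D of an occurrence of UD. *)
Definition kept (k : nat) : bool :=
  [exists j : 'I_(size alpha), (j <= k) && occ alpha p (k - j)]
  && (nth 0%R p k \in [:: U; F]).

Definition lower_step (k : nat) (y : int) : int :=
  if kept k then nth 0%R p k else if (0 < y)%R then D else F.

Fixpoint lower_height (k : nat) : int :=
  if k is k'.+1 then (lower_height k' + lower_step k' (lower_height k'))%R
  else 0%R.

Definition lowering (k : nat) : int := lower_step k (lower_height k).

(** A kept step moves both paths alike and, being U or F, does not descend. Otherwise the lowered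
    path goes down by 1, the steepest descent open to [p], or rests on the axis, which [p] never
    crosses. *)
Lemma lower_height_bounds (n : nat) :
  (forall k, k <= n -> (0 <= height p k)%R) ->
  (forall k, -1 <= nth 0 p k)%R ->
  forall k, k <= n -> (0 <= lower_height k <= height p k)%R.
Proof.
move=> hp hs; elim=> [|k IH] hk; first by rewrite height0.
have := hp _ hk; have := hs k; have := IH (ltnW hk).
rewrite heightS /= /lower_step /kept !inE /U /F /D.
by case: ifP => [/andP[_ /orP[]/eqP ->]|_]; [lia|lia|case: ifP; lia].
Qed.

Lemma lowering_UFD (k : nat) : lowering k \in [:: U; F; D].
Proof.
rewrite /lowering /lower_step.
case: ifP => [/andP[_]|_]; last by case: ifP.
by rewrite !inE => /orP[]->; rewrite ?orbT.
Qed.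

(** The descent rule yields only D and F, so every U was kept. This is what excludes new
    occurrences. *)
Lemma lowering_U (k : nat) : lowering k = U ->
  nth 0%R p k = U /\ exists j : 'I_(size alpha), j <= k /\ occ alpha p (k - j).
Proof.
rewrite /lowering /lower_step; case: ifP => [/andP[/existsP[j /andP[? ?]] _] ?|_].
  by split=> //; exists j.
by case: ifP.
Qed.

Lemma lowering_kept (k j : nat) : j < size alpha -> occ alpha p k ->
  nth 0%R p (k + j) \in [:: U; F] -> lowering (k + j) = nth 0%R p (k + j).
Proof.
move=> hj ho hk; rewrite /lowering /lower_step /kept hk andbT.
case: existsP => // -[]; exists (Ordinal hj) => /=.
by rewrite leq_addl addnK.
Qed.

(** After a U the lowered path is above the axis, and a D is never kept, so the descent rule
    applies. *)
Lemma lowering_UD (k : nat) : (0 <= lower_height k)%R ->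
  lowering k = U -> nth 0%R p k.+1 = D -> lowering k.+1 = D.
Proof.
rewrite /lowering /= /lower_step => h0 -> hD.
rewrite {1}/kept hD andbF ifT //; rewrite /U; lia.
Qed.

End Lowering.

Lemma Motzkin_lowering (alpha : seq int) (n : nat) (p : n.-tuple int) :
  Lukasiewicz p -> Motzkin (steps n (lowering alpha p)) /\
  forall k, k <= n -> (0 <= lower_height alpha p k)%R.
Proof.
move=> [[hp hn] hs].
have hs' k : (-1 <= nth 0 p k)%R.
  (* Past the end, [nth] returns the default 0, which satisfies the bound. *)
  case: (ltnP k (size p)) => hk; last by rewrite nth_default.
  by apply: hs; rewrite mem_nth.
have hb := @lower_height_bounds alpha _ _ hp hs'.
have h0 k : k <= n -> (0 <= lower_height alpha p k)%R by move/hb/andP=> [].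
split=> //; apply: (@Motzkin_steps _ _ (lower_height alpha p)) => //.
  by apply/eqP; rewrite eq_le h0 // andbT -hn; case/andP: (hb n (leqnn n)).
by move=> k _; exact: lowering_UFD.
Qed.

(** Occurrences survive since their U and F are kept and the D of UD is recreated. Conversely, a U
    of the lowered path is a U of [p] inside an occurrence: this settles U and UU, and for UD, UF
    and FU the place of the only U fixes where that occurrence starts. For DU the argument fails:
    the D may become F on the axis. *)
Lemma lowering_occ (alpha : seq int) (n : nat) (p : n.-tuple int) :
  alpha \in [:: [:: U]; [:: U; U]; [:: U; D]; [:: U; F]; [:: F; U]] ->
  Lukasiewicz p -> occ alpha p =1 occ alpha (steps n (lowering alpha p)).
Proof.
move=> ha hp i; have [_ h0] := Motzkin_lowering alpha hp.
have hl := @lowering_U alpha p; have hk := @lowering_kept alpha p i.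
move: ha h0 hl hk.
rewrite !inE => /or4P[/eqP->|/eqP->|/eqP->|/orP[]/eqP->] h0 hl hk.
- apply/idP/idP=> ho; have := elimT (occ1P _ _ _) ho; rewrite size_tuple => -[hi hU].
    apply/occ1P; rewrite size_tuple nth_steps //; split=> //.
    by have := hk 0 isT ho; rewrite addn0 hU => ->.
  move: hU; rewrite nth_steps // => /hl[hU _].
  by apply/occ1P; rewrite size_tuple.
- apply/idP/idP=> ho; have := elimT (occ2P _ _ _ _) ho;
    rewrite size_tuple => -[hi hU hV]; have hi' := ltnW hi.
    apply/occ2P; rewrite size_tuple !nth_steps //.
    have := hk 0 isT ho; have := hk 1 isT ho.
    by rewrite addn0 addn1 hU hV => -> // ->.
  move: hU hV; rewrite !nth_steps // => /hl[hU _] /hl[hV _].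
  by apply/occ2P; rewrite size_tuple.
- apply/idP/idP=> ho; have := elimT (occ2P _ _ _ _) ho;
    rewrite size_tuple => -[hi hU hV]; have hi' := ltnW hi.
    apply/occ2P; rewrite size_tuple !nth_steps //.
    have hU' : lowering [:: U; D] p i = U.
      by have := hk 0 isT ho; rewrite addn0 hU => ->.
    split=> //.
    by apply: lowering_UD hU' hV; rewrite h0 // ltnW.
  (* Offset 0 is the wanted occurrence; offset 1 would make this U the letter D. *)
  move: hU; rewrite nth_steps // => /hl[hU [[[|[|//]] /= hj] [ij]]].
    by rewrite subn0.
  by case/occ2P=> _ _; rewrite subn1 prednK // hU.
- apply/idP/idP=> ho; have := elimT (occ2P _ _ _ _) ho;
    rewrite size_tuple => -[hi hU hV]; have hi' := ltnW hi.
    apply/occ2P; rewrite size_tuple !nth_steps //.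
    have := hk 0 isT ho; have := hk 1 isT ho.
    by rewrite addn0 addn1 hU hV => -> // ->.
  move: hU; rewrite nth_steps // => /hl[hU [[[|[|//]] /= hj] [ij]]].
    by rewrite subn0.
  by case/occ2P=> _ _; rewrite subn1 prednK // hU.
- apply/idP/idP=> ho; have := elimT (occ2P _ _ _ _) ho;
    rewrite size_tuple => -[hi hU hV]; have hi' := ltnW hi.
    apply/occ2P; rewrite size_tuple !nth_steps //.
    have := hk 0 isT ho; have := hk 1 isT ho.
    by rewrite addn0 addn1 hU hV => -> // ->.
  (* Here U is the second letter, so offset 0 is the contradictory one. *)
  move: hV; rewrite nth_steps // => /hl[hV [[[|[|//]] /= hj] [ij]]].
    by rewrite subn0 => /occ2P[_]; rewrite hV.
  by rewrite subn1.
Qed.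

(** * Valleys, for the pattern DU *)

Definition valley_step (n : nat) (p : seq int) (k : nat) : int :=
  if occ [:: D; U] p k then D
  else if (0 < k) && occ [:: D; U] p k.-1 then U
  else if k == 0 then U else if k == n.-1 then D else F.

(** Height profile proposed for [valley_step]; an occurrence at [k.-1] marks the bottom of a
    valley. *)
Definition valley_height (n : nat) (p : seq int) (k : nat) : int :=
  if [|| k == 0, k >= n | occ [:: D; U] p k.-1] then 0%R else 1%R.

(** A first step D would cross the axis, a last step U would end above it, and no step is both D and
    U. Hence the clauses of [valley_step] do not compete. *)
Lemma lattice_path_DU (n : nat) (p : n.-tuple int) (k : nat) :
  lattice_path p -> occ [:: D; U] p k ->
  [/\ 0 < k, k.+2 < n & ~~ occ [:: D; U] p k.-1].
Proof.
move=> [hp hn] /occ2P[]; rewrite size_tuple => hk hD hU.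
have k0 : 0 < k.
  case: k hk hD {hU} => // hk hD.
  by have := hp 1 (ltnW hk); rewrite heightS height0 hD.
have hk1 := hp _ (ltnW hk).
split=> //.
  rewrite ltn_neqAle hk andbT; apply/eqP => nE.
  have: height p k.+2 = 0%R by rewrite nE.
  by move: hk1; rewrite (heightS p k.+1) hU /U; lia.
apply/negP => /occ2P[_ _]; rewrite prednK // hD.
by [].
Qed.

Lemma valley (n : nat) (p : n.-tuple int) (i : nat) : lattice_path p ->
  occ [:: D; U] p i ->
  Motzkin (steps n (valley_step n p)) /\
  occ [:: D; U] p =1 occ [:: D; U] (steps n (valley_step n p)).
Proof.
move=> hp hi; have hDU k := @lattice_path_DU n p k hp.
(* One occurrence forces [n >= 4], so the first and last steps differ; [lia] relies on this
   below. *)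
have [i0 hin _] := hDU _ hi.
split.
  apply: (@Motzkin_steps _ _ (valley_height n p)) => //.
  - move=> k hk; rewrite /valley_height /valley_step /=.
    have := hDU k; have := hDU k.-1; rewrite /U /D /F.
    case: (boolP (occ _ p k)) => _ hB hA.
      have [k0 kn /negPf ->] := hA isT.
      by do 2?case: ifP; lia.
    case: (boolP (occ _ p k.-1)) hB => _ hB; first have [k0 kn _] := hB isT.
      by do 4?case: ifP; lia.
    by do 6?case: ifP; lia.
  - by move=> k _; rewrite /valley_height; case: ifP.
  - by rewrite /valley_height leqnn orbT.
  - by move=> k _; rewrite /valley_step; do 4?case: ifP.
move=> k; apply/idP/idP=> ho.
  have [k0 kn _] := hDU _ ho; have hkn := ltnW kn.
  have hok : ~~ occ [:: D; U] p k.+1.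
    by apply/negP => /hDU[_ _]; rewrite /= ho.
  apply/occ2P; rewrite size_tuple !nth_steps //; last exact: ltnW.
  by rewrite /valley_step ho (negPf hok).
have := elimT (occ2P _ _ _ _) ho; rewrite size_tuple => -[hk]; have hk' := ltnW hk.
(* The U at [k.+1] decides alone: after the first step, a U arises only from an occurrence in
   [p]. *)
rewrite !nth_steps // => _; rewrite {1}/valley_step /=.
case: ifP => // _; case: ifP => // _.
by case: ifP.
Qed.

Lemma Motzkin_flat (n : nat) : Motzkin (steps n (fun=> F)).
Proof. by apply: (@Motzkin_steps _ _ (fun=> 0%R)). Qed.

(** * From Motzkin representatives to equal numbers of classes *)

Lemma Lukasiewicz_equiv_Motzkin (alpha : seq int) (n : nat) (p : n.-tuple int) :
  alpha \in [:: [:: U]; [:: U; U]; [:: U; D]; [:: U; F]; [:: D; U]; [:: F; U]] ->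
  Lukasiewicz p -> exists2 q : n.-tuple int, Motzkin q & alpha_equiv alpha p q.
Proof.
move=> ha hp; case: (eqVneq alpha [:: D; U]) => [->|hDU].
  case: (pselect (exists i, occ [:: D; U] p i)) => [[i hi]|hno].
    have [hM ho] := valley hp.1 hi.
    by exists (steps n (valley_step n p)) => //; exact: eq_positions.
  exists (steps n (fun=> F)); first exact: Motzkin_flat.
  apply: eq_positions => k; apply/idP/idP => [hk|]; first by case: hno; exists k.
  by case/occ2P; rewrite size_tuple => hk; rewrite nth_steps // ltnW.
exists (steps n (lowering alpha p)); first by have [] := Motzkin_lowering alpha hp.
apply: eq_positions; apply: lowering_occ => //.
by move: ha; rewrite !inE (negPf hDU).
Qed.

Lemma Motzkin_Lukasiewicz (n : nat) : @Motzkin n `<=` @Lukasiewicz n.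
Proof.
move=> p [hp hs]; split=> // s /hs.
by rewrite !inE => /or3P[] /eqP ->.
Qed.

(** A class is the fibre of [positions alpha] over a realized set; being nonempty, it determines
    that set. *)
Lemma card_equiv_classes (alpha : seq int) (n : nat) (A : set (n.-tuple int)) :
  equiv_classes alpha A #= [set positions alpha p | p in A].
Proof.
set cls := fun T : set nat => [set q | A q /\ T = positions alpha q].
have -> : equiv_classes alpha A = cls @` (positions alpha @` A).
  apply/seteqP; split=> C.
    by move=> [p Ap ->]; exists (positions alpha p) => //; exists p.
  by move=> [_ [p Ap <-] <-]; exists p.
apply: inj_card_eq => S T; rewrite !inE => -[p Ap <-] _ hST.
have : cls (positions alpha p) p by [].
by rewrite hST => -[].
Qed.

(** A nonempty pattern occurs only at positions from 1 to [n], which leaves finitely many sets; this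
    provides the number [k] of the theorem. *)
Lemma finite_positions (alpha : seq int) (n : nat) (A : set (n.-tuple int)) :
  alpha != [::] -> finite_set [set positions alpha p | p in A].
Proof.
move=> ha; pose f (S : {set 'I_n.+1}) : set nat := [set val i | i in [set` S]].
apply: (@sub_finite_set _ _ (range f)); last exact: finite_image.
move=> _ [p Ap <-].
exists [set i : 'I_n.+1 | (0 < i) && occ alpha p i.-1]%SET => //.
apply/seteqP; split=> i.
  by move=> [j /=]; rewrite inE => /andP[j0 hj] <-; split.
move=> [i0 hi]; have hin : i < n.+1.
  have := elimT (prefix_nthP 0%R _ _) hi; rewrite size_drop size_tuple => -[h _].
  by move: ha; rewrite -size_eq0 -lt0n => /leq_trans/(_ h); lia.
by exists (Ordinal hin) => //=; rewrite inE i0.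
Qed.

Theorem theorem1 (alpha : seq int) (n : nat)
    (halpha : alpha \in [:: [:: U]; [:: U; U]; [:: U; D]; [:: U; F];
                            [:: D; U]; [:: F; U]]) :
  exists k : nat,
    equiv_classes alpha (@Lukasiewicz n) #= `I_k /\
    equiv_classes alpha (@Motzkin n) #= `I_k.
Proof.
have ha : alpha != [::] by apply: contraL halpha => /eqP ->.
have [k hk] := finite_positions (@Motzkin n) ha.
exists k; split; last exact: card_eq_trans (card_equiv_classes _ _) hk.
apply: card_eq_trans (card_equiv_classes _ _) _.
suff -> : [set positions alpha p | p in @Lukasiewicz n] =
          [set positions alpha p | p in @Motzkin n] by [].
apply/seteqP; split=> _ [p hp <-].
  by have [q hq ->] := Lukasiewicz_equiv_Motzkin halpha hp; exists q.
by exists p => //; exact: Motzkin_Lukasiewicz.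
Qed.
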